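(* Let $M=(M_p)_{p\in\mathbb{N}}\in\mathcal{LC}$ be given and suppose that $M$ has moderate growth, i.e. there is $C\ge 1$ with $M_{p+q}\le C^{p+q}M_pM_q$ for all $p,q\in\mathbb{N}$. Put $m_p:=M_p/p!$, and $\mu_p:=M_p/M_{p-1}$ for $p\ge1$. Then the following properties are equivalent: (i) $\exists\,B\ge 1\;\forall\,\lambda,p\in\mathbb{N}_{>0}:\ \lambda (M_p)^{1/p}\le B\,(M_{\lambda p})^{1/(\lambda p)}$. (ii) $\exists\,B\ge 1\;\forall\,\lambda,p\in\mathbb{N}_{>0}:\ \lambda\mu_p\le B\,\mu_{\lambda p}$. (iii) $M$ is root almost increasing, i.e. $\exists\,A\ge 1\;\forall\,1\le p\le q:\ (m_p)^{1/p}\le A\,(m_q)^{1/q}$. (iv) The sequence $(\mu_p/p)_{p\ge 1}$ is almost increasing, i.e. $\exists\,A\ge 1\;\forall\,1\le p\le q:\ \frac{\mu_p}{p}\le A\,\frac{\mu_q}{q}$. (v) There exists $S=(S_p)_{p\in\mathbb{N}}\in\mathcal{LC}$ such that $M\approx S$ and the sequence $s=(s_p)_p$, $s_p:=S_p/p!$, is log-convex (i.e. $M$ is equivalent to a strongly log-convex weight sequence $S$). (vi) $\omega_M$ satisfies $(\alpha_0)$, i.e. $\exists\,C\ge 1\;\exists\,t_0\ge 0\;\forall\,\lambda\ge 1\;\forall\,t\ge t_0:\ \omega_M(\lambda t)\le C\lambda\,\omega_M(t)$; i.e. $\omega_M$ is equivalent to a subadditive weight function. (vii) The weight matrix $\mathcal{M}_{\omega_M}=\{M^{(l)}:l>0\}$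 associated with $\omega_M$ satisfies: $\forall\,x>0\;\exists\,C>0\;\exists\,y>0\;\forall\,1\le p\le q:\ (m^{(x)}_p)^{1/p}\le C\,(m^{(y)}_q)^{1/q}$, where $m^{(l)}_p:=M^{(l)}_p/p!$.
   Context: Notation: $\mathbb{N}=\{0,1,2,\dots\}$, $\mathbb{N}_{>0}=\{1,2,3,\dots\}$; $p,q$ in (iii), (iv), (vii) are integers. A sequence $(a_p)_{p\in\mathbb{N}}$ of positive reals is log-convex if $a_p^2\le a_{p-1}a_{p+1}$ for all $p\ge1$. $\mathcal{LC}$ denotes the set of all sequences $M=(M_p)_{p\in\mathbb{N}}$ of positive reals that are normalized ($1=M_0\le M_1$), log-convex and satisfy $\lim_{p\to+\infty}(M_p)^{1/p}=+\infty$. For sequences $M,N$ of positive reals write $M\preceq N$ if $\sup_{p\ge1}(M_p/N_p)^{1/p}<+\infty$, and $M\approx N$ (equivalent) if $M\preceq N$ and $N\preceq M$. The associated weight function of $M$ is $\omega_M:[0,+\infty)\to[0,+\infty)$, $\omega_M(t):=\sup_{p\in\mathbb{N}}\log\left(\frac{t^p}{M_p}\right)$ for $t>0$, $\omega_M(0):=0$. A weight function is a continuous nondecreasing $\omega:[0,+\infty)\to[0,+\infty)$ with $\omega(0)=0$ and $\lim_{t\to+\infty}\omega(t)=+\infty$; two weight functions $\sigma,\tau$ are equivalent if $\sigma(t)=O(\tau(t))$ and $\tau(t)=O(\sigma(t))$ as $t\to+\infty$; $\sigma$ is subadditive if $\sigma(s+t)\le\sigma(s)+\sigma(t)$ for all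 $s,t\ge0$. The weight matrix associated with $\omega_M$ is $\mathcal{M}_{\omega_M}:=\{M^{(l)}=(M^{(l)}_p)_{p\in\mathbb{N}}: l>0\}$ with $M^{(l)}_p:=\exp\left(\frac1l\varphi^*_{\omega_M}(lp)\right)$, where $\varphi_{\omega_M}(y):=\omega_M(e^y)$ and $\varphi^*_{\omega_M}(x):=\sup\{xy-\varphi_{\omega_M}(y): y\ge 0\}$ for $x\ge 0$. *)

(* Defs.v *)
From mathcomp Require Import all_boot all_order all_algebra.
From mathcomp Require Import all_classical all_reals all_analysis.

Set Implicit Arguments.
Unset Strict Implicit.
Unset Printing Implicit Defensive.

Import Order.TTheory GRing.Theory Num.Theory numFieldNormedType.Exports.

Local Open Scope classical_set_scope.
Local Open Scope ring_scope.

Section WeightSequences.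
Context {R : realType}.
Implicit Types (a M N : nat -> R) (w sigma tau : R -> R).

Definition log_convex a : Prop :=
  forall p : nat, (1 <= p)%N -> a p ^+ 2 <= a p.-1 * a p.+1.

Definition LC M : Prop :=
  [/\ forall p, 0 < M p,
      M 0%N = 1 /\ 1 <= M 1%N,
      log_convex M
    & (fun p : nat => M p `^ (p%:R)^-1) @ \oo --> +oo].

Definition seq_preceq M N : Prop :=
  (ereal_sup [set ((M p / N p) `^ (p%:R)^-1)%:E | p in [set p | (1 <= p)%N]]
   < +oo)%E.

Definition seq_equiv M N : Prop := seq_preceq M N /\ seq_preceq N M.

Definition moderate_growth M : Prop :=
  exists2 C : R, 1 <= C &
    forall p q : nat, M (p + q)%N <= C ^+ (p + q) * M p * M q.

Definition div_fact M : nat -> R := fun p => M p / p`!%:R.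

(* Only meaningful for [1 <= p]. *)
Definition ratio_seq M : nat -> R := fun p => M p / M p.-1.

Definition almost_increasing a : Prop :=
  exists2 A : R, 1 <= A &
    forall p q : nat, (1 <= p <= q)%N -> a p <= A * a q.

Definition root_almost_increasing M : Prop :=
  almost_increasing (fun p => div_fact M p `^ (p%:R)^-1).

(* Weight functions live on [0, +oo[; they are encoded as total functions
   [R -> R] whose values on negative arguments are irrelevant. *)

(* The real-valued [sup] is the true supremum whenever [LC M]: the set contains
   [- ln (M 0) = 0], and it is bounded above because [(M p)^(1/p)] tends to
   infinity. *)
Definition omega M (t : R) : R :=
  if 0 < t then sup [set ln (t ^+ p / M p) | p in [set: nat]] else 0.

Definition weight_function w : Prop :=
  [/\ {within `[0, +oo[%classic, continuous w},
      forall s t : R, 0 <= s -> s <= t -> w s <= w t,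
      forall t : R, 0 <= t -> 0 <= w t,
      w 0 = 0
    & w t @[t --> +oo] --> +oo].

(* The filter at +oo, packaged so that the notation [=O_] accepts it. *)
Canonical pinfty_filter_on : filter_on R :=
  FilterType (pinfty_nbhs R) (@filter_filter R _ proper_pinfty_nbhs).

Definition weight_equiv sigma tau : Prop :=
  sigma =O_ pinfty_filter_on tau /\ tau =O_ pinfty_filter_on sigma.

Definition subadditive_weight sigma : Prop :=
  forall s t : R, 0 <= s -> 0 <= t -> sigma (s + t) <= sigma s + sigma t.

Definition alpha0 w : Prop :=
  exists C : R, exists t0 : R,
    [/\ 1 <= C, 0 <= t0
      & forall lambda t : R, 1 <= lambda -> t0 <= t ->
          w (lambda * t) <= C * lambda * w t].

Definition phi w : R -> R := fun y => w (expR y).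

(* For [w = omega M] with [LC M] and [0 <= x] the set is nonempty and bounded
   above, since [omega M] dominates every multiple of the logarithm at
   infinity; so [sup] is again the true supremum. *)
Definition phi_star w (x : R) : R :=
  sup [set x * y - phi w y | y in [set y : R | 0 <= y]].

Definition weight_matrix w (l : R) : nat -> R :=
  fun p => expR (l^-1 * phi_star w (l * p%:R)).

End WeightSequences.

(* Main.v *)
(* Write [r p = M p `^ (1/p)] and [mu p = M p / M p.-1]. Log-convexity gives
   [r <= mu], moderate growth gives [mu <= D r], and [p / e <= (p!)^(1/p) <= p];
   so (i)-(iv) all say that [r p / p] is almost increasing.

   From (iv), replacing [mu p / p] by its running maximum yields the strongly
   log-convex sequence of (v); conversely the roots of a normalized log-convex
   sequence increase.

   [omega M] and [M] determine each other: [M p] is the supremum of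
   [t ^ p / exp (omega M t)], attained at [t = mu p]. If [r p / p] is almost
   increasing with constant [A], comparing the index [p] with
   [k = floor (p / lambda)] bounds [omega M (lambda t)] by
   [2 lambda (omega M (A t))] for large [t]. Conversely, (alpha_0) at [t = mu p]
   gives [lambda (r p) <= r (n lambda p)] for large [p] and [n >= C]; moderate
   growth absorbs [n].

   The subadditive weight is [sup_(lambda >= 1) omega M (lambda t) / lambda].
   For (vii), [(M^(l)_p)^(1/p) = exp (phi^* (l p) / (l p))] is nondecreasing in
   [l] and equals [r (l p)] when [l] is an integer. *)
Require Import Defs.
From mathcomp Require Import all_boot all_order all_algebra.
From mathcomp Require Import all_classical all_reals all_analysis.
From mathcomp Require Import zify ring lra.

Set Implicit Arguments.
Unset Strict Implicit.
Unset Printing Implicit Defensive.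

Import Order.TTheory GRing.Theory Num.Theory numFieldNormedType.Exports.

Local Open Scope classical_set_scope.
Local Open Scope ring_scope.

(** * Roots of sequences and the comparison of [p!] with [p ^ p] *)

Section Roots.
Context {R : realType}.
Implicit Types (a b : nat -> R) (x y : R) (p q : nat).

Definition nroot a p : R := a p `^ (p%:R)^-1.

Lemma nrootX a p : 0 <= a p -> (0 < p)%N -> nroot a p ^+ p = a p.
Proof.
move=> a0 p0; rewrite -powR_mulrn ?powR_ge0// -powRrM mulVf ?powRr1//.
by rewrite pnatr_eq0 -lt0n.
Qed.

Lemma nroot_gt0 a p : 0 < a p -> 0 < nroot a p.
Proof. exact: powR_gt0. Qed.

Lemma le_nroot a p x : 0 <= x -> 0 <= a p -> (0 < p)%N ->
  (x <= nroot a p) = (x ^+ p <= a p).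
Proof.
by move=> x0 a0 p0; rewrite -(nrootX a0 p0) ler_pXn2r// nnegrE powR_ge0.
Qed.

Lemma nroot_le a p x : 0 <= x -> 0 <= a p -> (0 < p)%N ->
  (nroot a p <= x) = (a p <= x ^+ p).
Proof.
by move=> x0 a0 p0; rewrite -(nrootX a0 p0) ler_pXn2r// nnegrE powR_ge0.
Qed.

Lemma ln_nroot a p : ln (nroot a p) = ln (a p) / p%:R.
Proof. by rewrite ln_powR mulrC. Qed.

Lemma almost_increasing_comparable a b (K L : R) :
  0 < K -> 0 < L ->
  (forall p, (0 < p)%N -> b p <= K * a p) ->
  (forall p, (0 < p)%N -> a p <= L * b p) ->
  (forall p, (0 < p)%N -> 0 <= b p) ->
  almost_increasing a -> almost_increasing b.
Proof.
move=> K0 L0 ba ab b0 [A A1 aA]; have A0 : 0 < A by exact: lt_le_trans A1.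
(* The maximum with 1 meets the demand [1 <= A]; raising the constant is harmless because [b] is
   nonnegative. *)
exists (Num.max 1 (K * A * L)); first by rewrite le_max lexx.
move=> p q /andP[p0 pq]; have q0 : (0 < q)%N by exact: leq_trans pq.
apply: (le_trans (ba _ p0)); apply: (@le_trans _ _ (K * A * L * b q)).
  rewrite -!mulrA ler_pM2l//; apply: (@le_trans _ _ (A * a q)).
    by apply: aA; rewrite p0.
  by rewrite ler_pM2l// ab.
by rewrite ler_wpM2r ?b0// le_max lexx orbT.
Qed.

Lemma nfact_le_exp p : (p`! <= p ^ p)%N.
Proof.
elim: p => // -[//|p] IH; rewrite factS expnS leq_mul2l/=.
by apply: (leq_trans IH); rewrite leq_exp2r.
Qed.

(** Induction: from [p] to [p + 1] the left side grows by the factor [(p + 1) * (1 + 1/p) ^ p], and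
    [1 + 1/p <= exp (1/p)] bounds this by [e * (p + 1)]. *)
Lemma exp_le_fact p : (p%:R ^+ p : R) <= expR 1 ^+ p * p`!%:R.
Proof.
elim: p => [|p IH]; first by rewrite !expr0 mul1r.
case: p IH => [|p] IH.
  rewrite !expr1 mulr1; apply: le_trans (expR_ge1Dx 1); lra.
have p0 : (0 : R) < p.+1%:R by rewrite ltr0n.
have step : (p.+2%:R : R) ^+ p.+1 <= expR 1 * p.+1%:R ^+ p.+1.
  have -> : (p.+2%:R : R) = (1 + p.+1%:R^-1) * p.+1%:R.
    by rewrite mulrDl mul1r mulVf ?gt_eqF// natr1.
  rewrite exprMn ler_pM2r ?exprn_gt0//.
  have -> : expR 1 = expR p.+1%:R^-1 ^+ p.+1 :> R.
    by rewrite -expRM_natr mulVf ?gt_eqF.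
  have i0 : 0 <= 1 + p.+1%:R^-1 :> R by rewrite addr_ge0// invr_ge0 ltW.
  by rewrite ler_pXn2r ?nnegrE ?expR_ge0// expR_ge1Dx.
rewrite exprS factS natrM.
have -> : expR 1 ^+ p.+2 * (p.+2%:R * p.+1`!%:R) =
  p.+2%:R * (expR 1 * (expR 1 ^+ p.+1 * p.+1`!%:R)) :> R by rewrite exprS; ring.
rewrite ler_pM2l ?ltr0n//; apply: (le_trans step).
by rewrite ler_pM2l ?expR_gt0.
Qed.

Lemma nroot_div_fact_le a p : 0 < a p -> (0 < p)%N ->
  nroot (div_fact a) p <= expR 1 * (nroot a p / p%:R).
Proof.
move=> a0 p0; have f0 : (0 : R) < p`!%:R by rewrite ltr0n fact_gt0.
have pR0 : (0 : R) < p%:R by rewrite ltr0n.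
rewrite nroot_le//; last first.
- by rewrite divr_ge0// ltW.
- by rewrite mulr_ge0 ?expR_ge0// divr_ge0 ?powR_ge0.
rewrite /div_fact exprMn expr_div_n nrootX ?(ltW a0)// mulrCA ler_pM2l//.
rewrite ler_pdivlMr ?exprn_gt0// mulrC ler_pdivrMr//.
exact: exp_le_fact.
Qed.

Lemma nroot_div_fact_ge a p : 0 < a p -> (0 < p)%N ->
  nroot a p / p%:R <= nroot (div_fact a) p.
Proof.
move=> a0 p0; have f0 : (0 : R) < p`!%:R by rewrite ltr0n fact_gt0.
have pR0 : (0 : R) < p%:R by rewrite ltr0n.
rewrite le_nroot//; last first.
- by rewrite divr_ge0// ltW.
- by rewrite divr_ge0 ?powR_ge0.
rewrite /div_fact expr_div_n nrootX ?(ltW a0)// ler_pM2l//.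
by rewrite lef_pV2 ?posrE ?exprn_gt0// -natrX ler_nat nfact_le_exp.
Qed.

Lemma root_almost_increasingE a : (forall p, 0 < a p) ->
  root_almost_increasing a <->
  almost_increasing (fun p => nroot a p / p%:R).
Proof.
move=> a0; have e0 := @expR_gt0 R 1.
split; [apply: (@almost_increasing_comparable _ _ 1 (expR 1))
       |apply: (@almost_increasing_comparable _ _ (expR 1) 1)] => //= p p0;
  rewrite ?mul1r ?nroot_div_fact_le ?nroot_div_fact_ge//.
- by rewrite divr_ge0 ?powR_ge0.
- by rewrite powR_ge0.
Qed.
End Roots.

(** * Log-convex sequences: quotients and roots *)

Section LogConvex.
Context {R : realType} (a : nat -> R).
Hypotheses (a_gt0 : forall p, 0 < a p) (a_lc : log_convex a).
Implicit Types p q k : nat.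

Lemma ratio_seq_gt0 p : 0 < ratio_seq a p.
Proof. by rewrite divr_gt0. Qed.

Lemma mul_ratio_seq p : a p * ratio_seq a p.+1 = a p.+1.
Proof. by rewrite /ratio_seq/= mulrCA mulfV ?mulr1// gt_eqF. Qed.

Lemma ratio_seqS p : (0 < p)%N -> ratio_seq a p <= ratio_seq a p.+1.
Proof.
move=> p0; rewrite /ratio_seq ler_pdivrMr//= mulrAC ler_pdivlMr//.
by rewrite -expr2 mulrC a_lc.
Qed.

Lemma ratio_seq_homo p q : (0 < p)%N -> (p <= q)%N ->
  ratio_seq a p <= ratio_seq a q.
Proof.
move=> p0 /subnKC <-; elim: (q - p)%N => [|n IH]; first by rewrite addn0.
by rewrite addnS; apply: (le_trans IH); rewrite ratio_seqS// ltn_addr.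
Qed.

(* [p |-> t ^+ p / a p] is maximal at [k] for [t = a k / a k.-1]. *)
Lemma ratio_seq_max k p : (0 < k)%N ->
  ratio_seq a k ^+ p * a k <= ratio_seq a k ^+ k * a p.
Proof.
move=> k0; have m0 := ratio_seq_gt0 k.
have [kp|pk] := leqP k p.
  rewrite -(subnKC kp); elim: (p - k)%N => [|n IH]; first by rewrite addn0.
  rewrite addnS exprSr mulrAC -(mul_ratio_seq (k + n)) mulrA.
  apply: ler_pM => //; [|exact: ltW|by rewrite ratio_seq_homo// leqW ?leq_addr].
  by rewrite mulr_ge0 ?exprn_ge0// ltW.
(* Below [k], descend from [k] to [p]: each quotient removed has index at most [k], hence is at most
   [ratio_seq a k]. *)
suff H n : (n <= k)%N -> a k <= ratio_seq a k ^+ n * a (k - n)%N.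
  have := H (k - p)%N (leq_subr _ _); rewrite subKn ?(ltnW pk)// => /ler_wpM2l.
  move=> /(_ (ratio_seq a k ^+ p)); rewrite mulrA -exprD subnKC ?(ltnW pk)//.
  by apply; rewrite exprn_ge0// ltW.
elim: n => [|n IH] nk; first by rewrite subn0 expr0 mul1r.
apply: (le_trans (IH (ltnW nk))).
rewrite exprSr -mulrA ler_pM2l ?exprn_gt0//.
rewrite subnS; have kn : (0 < k - n)%N by rewrite subn_gt0.
rewrite -[X in a X <= _](prednK kn) -mul_ratio_seq mulrC ler_pM2r// prednK//.
by rewrite ratio_seq_homo// leq_subr.
Qed.

Hypothesis a0 : a 0%N = 1.

(** Maximality at [p], compared with the index 0, where [a] equals 1. *)
Lemma nroot_le_ratio p : (0 < p)%N -> nroot a p <= ratio_seq a p.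
Proof.
move=> p0; rewrite nroot_le ?(ltW (a_gt0 _)) ?(ltW (ratio_seq_gt0 _))//.
by have := ratio_seq_max 0 p0; rewrite a0 expr0 mul1r mulr1.
Qed.

(** Passing from [k] to [k + 1] multiplies [a k] by a quotient that is at least [nroot a k], so
    [nroot a k ^+ k.+1 <= a k.+1]. *)
Lemma nroot_homo p q : (0 < p)%N -> (p <= q)%N -> nroot a p <= nroot a q.
Proof.
move=> p0 /subnKC <-; elim: (q - p)%N => [|n IH]; first by rewrite addn0.
rewrite addnS; apply: (le_trans IH); set k := (p + n)%N.
have k0 : (0 < k)%N by rewrite ltn_addr.
rewrite le_nroot ?powR_ge0 ?(ltW (a_gt0 _))// exprSr nrootX ?(ltW (a_gt0 _))//.
rewrite -mul_ratio_seq ler_pM2l//.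
by apply: (le_trans (nroot_le_ratio k0)); rewrite ratio_seqS.
Qed.

End LogConvex.

(** * Elementary bounds for weight sequences *)

Section Weights.
Context {R : realType} (M : nat -> R).
Hypothesis hM : LC M.
Implicit Types p q k n : nat.

Let M_gt0 p : 0 < M p. Proof. by case: hM. Qed.
Let M_lc : log_convex M. Proof. by case: hM. Qed.
Let M0 : M 0%N = 1. Proof. by case: hM => _ []. Qed.

Lemma LC_ratio_ge1 p : (0 < p)%N -> 1 <= ratio_seq M p.
Proof.
move=> p0; have [_ [_ M1] _ _] := hM.
apply: (@le_trans _ _ (ratio_seq M 1)); last exact: ratio_seq_homo.
by rewrite /ratio_seq M0 divr1.
Qed.

Lemma LC_ge1 p : 1 <= M p.
Proof.
elim: p => [|p IH]; first by rewrite M0.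
by rewrite -mul_ratio_seq// mulr_ege1// LC_ratio_ge1.
Qed.

Lemma nroot_unbounded (x : R) : exists2 k, (0 < k)%N & x <= nroot M k.
Proof.
have [_ _ _ /cvgryPge/(_ x)[N _ H]] := hM.
by exists N.+1 => //; apply: H => /=.
Qed.

Lemma ratio_unbounded (x : R) : exists2 k, (0 < k)%N & x <= ratio_seq M k.
Proof.
have [k k0 xk] := nroot_unbounded x.
by exists k => //; apply: (le_trans xk); exact: nroot_le_ratio.
Qed.

End Weights.

(** * Consequences of moderate growth *)

Section ModerateGrowth.
Context {R : realType} (M : nat -> R).
Hypotheses (hM : LC M) (hmg : moderate_growth M).
Implicit Types p q k n : nat.

Let M_gt0 p : 0 < M p. Proof. by case: hM. Qed.
Let M_lc : log_convex M. Proof. by case: hM. Qed.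
Let M0 : M 0%N = 1. Proof. by case: hM => _ []. Qed.

(** With [mu = ratio_seq M p.+1], maximality at [p + 1] compared with the index [2p] gives [mu ^ p *
    M p <= M (2p) <= C ^ (2p) * M p ^ 2]. Hence [mu <= C ^ 2 * nroot M p], and the quotient at [p]
    is smaller still. *)
Lemma moderate_growth_ratio :
  exists2 D : R, 0 < D & forall p, (0 < p)%N -> ratio_seq M p <= D * nroot M p.
Proof.
have [C C1 mg] := hmg; have C0 : 0 < C by exact: lt_le_trans C1.
exists (C ^+ 2) => [|p p0]; first by rewrite exprn_gt0.
have D0 : 0 < C ^+ 2 by rewrite exprn_gt0.
have m0 := ratio_seq_gt0 M_gt0 p.+1.
rewrite mulrC -ler_pdivrMr//.
apply: (@le_trans _ _ (ratio_seq M p.+1 / C ^+ 2)).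
  by rewrite ler_pM2r ?invr_gt0// ratio_seqS.
rewrite le_nroot ?(ltW (M_gt0 _))//; last by apply: divr_ge0; apply: ltW.
rewrite expr_div_n ler_pdivrMr ?exprn_gt0// -exprM.
have := ratio_seq_max M_gt0 M_lc (p + p)%N (ltn0Sn p).
rewrite exprD exprS -(mul_ratio_seq M_gt0) => H.
have {}H : ratio_seq M p.+1 ^+ p * M p <= M (p + p)%N.
  rewrite -(@ler_pM2l _ (ratio_seq M p.+1 * ratio_seq M p.+1 ^+ p)).
    by rewrite (le_trans _ H)// le_eqVlt; apply/orP; left; apply/eqP; ring.
  by rewrite mulr_gt0// exprn_gt0.
have {H} := le_trans H (mg p p); rewrite ler_pM2r// addnn -mul2n => H.
by rewrite mulrC.
Qed.

Lemma moderate_growth_nroot : exists2 C : R, 1 <= C &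
  forall n p, (0 < n)%N -> (0 < p)%N -> nroot M (n * p) <= C ^+ n * nroot M p.
Proof.
have [C C1 mg] := hmg; have C0 : 0 < C by exact: lt_le_trans C1.
exists C => // n p n0 p0.
have r0 : 0 <= nroot M p by exact: powR_ge0.
rewrite nroot_le ?muln_gt0 ?n0 ?(ltW (M_gt0 _))//; last first.
  by rewrite mulr_ge0 ?exprn_ge0// ltW.
rewrite exprMn -exprM [X in nroot M p ^+ X]mulnC [nroot M p ^+ _]exprM.
rewrite nrootX ?(ltW (M_gt0 _))//.
(* Splitting off one block of length [p] costs [C ^ (p + n p)]; the exponent [n * (n * p)] leaves
   room for it, since [p + n p + n^2 p <= (n + 1)^2 p]. *)
elim: n {n0} => [|n IH]; first by rewrite !mul0n expr0 mulr1 M0.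
rewrite [X in M X]mulSn; apply: (le_trans (mg _ _)).
apply: (@le_trans _ _
  (C ^+ (p + n * p) * M p * (C ^+ (n * (n * p)) * M p ^+ n))).
  by rewrite ler_pM2l// mulr_gt0// exprn_gt0.
have -> : C ^+ (p + n * p) * M p * (C ^+ (n * (n * p)) * M p ^+ n) =
  C ^+ (p + n * p) * C ^+ (n * (n * p)) * M p ^+ n.+1 by rewrite exprS; ring.
by rewrite -exprD ler_pM2r ?exprn_gt0// ler_weXn2l//; nia.
Qed.

End ModerateGrowth.

(** * The associated weight function and condition (alpha_0) *)

Section Omega.
Context {R : realType} (M : nat -> R).
Hypothesis hM : LC M.
Implicit Types (p q k n : nat) (s t x y b : R).

Let M_gt0 p : 0 < M p. Proof. by case: hM. Qed.
Let M_lc : log_convex M. Proof. by case: hM. Qed.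
Let M0 : M 0%N = 1. Proof. by case: hM => _ []. Qed.

Lemma ln_omegaE p t : 0 < t ->
  ln (t ^+ p / M p) = p%:R * ln t - ln (M p).
Proof.
by move=> t0; rewrite ln_div ?posrE ?exprn_gt0// lnXn// mulr_natl.
Qed.

(** Fix [k] with [t <= nroot M k]. Beyond [k] the terms [t ^ p / M p] are at most 1, because roots
    increase; up to [k] they are at most [max t 1 ^ k], because [M p >= 1]. *)
Lemma omega_has_ubound t : 0 < t ->
  has_ubound [set ln (t ^+ p / M p) | p in [set: nat]].
Proof.
move=> t0; have [k k0 tk] := nroot_unbounded hM t.
pose u := Num.max t 1.
have u1 : 1 <= u by rewrite le_max lexx orbT.
have tu : t <= u by rewrite le_max lexx.
have u0 : 0 < u by exact: lt_le_trans u1.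
exists (ln (u ^+ k)) => _ [p _ <-].
rewrite ler_ln ?posrE ?divr_gt0 ?exprn_gt0//.
have [pk|kp] := leqP p k.
  apply: (@le_trans _ _ (t ^+ p)).
    by rewrite ler_pdivrMr// ler_peMr ?exprn_ge0 ?(ltW t0)// LC_ge1.
  apply: (@le_trans _ _ (u ^+ p)); last exact: ler_weXn2l.
  by apply: lerXn2r; rewrite ?nnegrE ?(ltW t0) ?(ltW u0).
apply: (@le_trans _ _ 1); last exact: exprn_ege1.
have p0 : (0 < p)%N by exact: leq_ltn_trans kp.
rewrite ler_pdivrMr// mul1r -le_nroot ?(ltW t0) ?(ltW (M_gt0 _))//.
by apply: (le_trans tk); rewrite nroot_homo// ltnW.
Qed.

Lemma omega_ge p t : 0 < t -> p%:R * ln t - ln (M p) <= omega M t.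
Proof.
move=> t0; rewrite -ln_omegaE// /omega t0.
by apply: ub_le_sup; [exact: omega_has_ubound|exists p].
Qed.

Lemma omega_le t b : 0 < t -> (forall p, p%:R * ln t - ln (M p) <= b) ->
  omega M t <= b.
Proof.
move=> t0 H; rewrite /omega t0; apply: ge_sup.
  by exists (ln (t ^+ 0 / M 0)); exists 0%N.
by move=> _ [p _ <-]; rewrite ln_omegaE.
Qed.

Lemma omega_npos t : t <= 0 -> omega M t = 0.
Proof. by rewrite /omega ltNge => ->. Qed.

Lemma omega_ge0 t : 0 <= omega M t.
Proof.
have [t0|/omega_npos->//] := ltP 0 t.
by apply: le_trans (omega_ge 0 t0); rewrite mul0r M0 ln1 subr0.
Qed.

Lemma omega_homo s t : s <= t -> omega M s <= omega M t.
Proof.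
move=> st; have [s0|/omega_npos->] := ltP 0 s; last exact: omega_ge0.
have t0 : 0 < t by exact: lt_le_trans st.
apply: omega_le => // p; apply: le_trans (omega_ge p t0).
by rewrite lerD2r ler_wpM2l// ler_ln.
Qed.

Lemma omega_le1 t : t <= 1 -> omega M t = 0.
Proof.
move=> t1; apply/eqP; rewrite eq_le omega_ge0 andbT.
apply: (le_trans (omega_homo t1)); apply: omega_le => // p.
by rewrite ln1 mulr0 sub0r oppr_le0 ln_ge0// LC_ge1.
Qed.

Lemma omega_ratio k : (0 < k)%N ->
  omega M (ratio_seq M k) = k%:R * ln (ratio_seq M k) - ln (M k).
Proof.
move=> k0; have m0 := ratio_seq_gt0 M_gt0 k.
apply/eqP; rewrite eq_le omega_ge// andbT; apply: omega_le => // p.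
have := ratio_seq_max M_gt0 M_lc p k0.
move: (ratio_seq M k) m0 => m m0.
have e0 q : m ^+ q \is Num.pos by rewrite posrE exprn_gt0.
have M0' q : M q \is Num.pos by rewrite posrE.
rewrite -ler_ln ?posrE ?mulr_gt0 ?exprn_gt0// !lnM// !lnXn//.
by rewrite -!(mulr_natl (ln m)); lra.
Qed.

Lemma ln_nrootM p : (0 < p)%N -> ln (M p) = p%:R * ln (nroot M p).
Proof.
by move=> p0; rewrite ln_nroot mulrCA mulfV ?mulr1// pnatr_eq0 -lt0n.
Qed.

Lemma almost_increasing_alpha0 :
  almost_increasing (fun p => nroot M p / p%:R) -> alpha0 (omega M).
Proof.
move=> [A A1 HA]; have A0 : 0 < A by exact: lt_le_trans A1.
have M1 := M_gt0 1; have r0 p := nroot_gt0 (M_gt0 p).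
have {}HA p q : (0 < p)%N -> (p <= q)%N ->
    ln (nroot M p) - ln p%:R <= ln A + (ln (nroot M q) - ln q%:R).
  move=> p0 pq; have q0 : (0 < q)%N by exact: leq_trans pq.
  have := HA p q; rewrite p0 pq => /(_ isT).
  have n0 n : (0 < n)%N -> nroot M n / n%:R \is Num.pos.
    by move=> n0; rewrite posrE divr_gt0// ltr0n.
  rewrite -ler_ln ?posrE ?mulr_gt0 ?invr_gt0 ?ltr0n//.
  by rewrite [X in _ <= X]lnM ?n0// !ln_div ?posrE ?ltr0n.
(* For [t >= M 1 * e] the term of index 1 gives [1 <= omega M (A * t)], which absorbs the additive
   [lambda] arising when [k = 0]. *)
pose t0 := Num.max 1 (M 1 * expR 1).
have key lambda t : 1 <= lambda -> t0 <= t ->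
    omega M (lambda * t) <= 2 * lambda * omega M (A * t).
  move=> l1; rewrite ge_max => /andP[t1 tM].
  have l0 : 0 < lambda by exact: lt_le_trans l1.
  have tp : 0 < t by exact: lt_le_trans t1.
  have Atp : 0 < A * t by exact: mulr_gt0.
  have lnA : 0 <= ln A by exact: ln_ge0.
  have lnt : ln (M 1) + 1 <= ln t.
    rewrite -[X in _ + X](expRK 1) -lnM ?posrE ?expR_gt0//.
    by rewrite ler_ln ?posrE ?mulr_gt0 ?expR_gt0.
  have := omega_ge 1 Atp; rewrite mul1r lnM // => w1.
  have w0 := omega_ge0 (A * t).
  have w1' : 1 <= omega M (A * t) by lra.
  apply: omega_le => [|p]; first exact: mulr_gt0.
  have [pz|p0] := posnP p.
    by rewrite pz mul0r M0 ln1 subr0 !mulr_ge0// ltW.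
  have pR0 : (0 : R) < p%:R by rewrite ltr0n.
  rewrite lnM ?posrE// ln_nrootM// -mulrBr.
  have pl0 : 0 <= p%:R / lambda by rewrite divr_ge0// ltW.
  have /andP[] := truncn_itv pl0; set k := Num.trunc _ => kp pk.
  have [k0|k0] := posnP k.
    (* Here [k = 0] is no usable index, so [p] is compared with the index 1. The excess
       [p * ln (lambda / p)] is below [lambda] by [ln x < x]; the rest is at most [p * W] with
       [W <= omega M (A * t)]. *)
    have pl : p%:R < lambda by move: pk; rewrite k0 ltr_pdivrMr// mul1r.
    have := HA 1%N p isT p0; rewrite ln_nroot divr1 ln1 subr0 => H1.
    have lnlp : p%:R * (ln lambda - ln p%:R) <= lambda.
      rewrite -ln_div ?posrE// -[X in _ <= X](@mulfVK _ p%:R) ?gt_eqF//.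
      rewrite mulrC ler_pM2r//.
      by rewrite ltW// ln_sublinear// divr_gt0.
    set W := ln A + ln t - ln (M 1).
    have pW : p%:R * W <= lambda * omega M (A * t).
      by apply: ler_pM; rewrite ?(ltW pl) ?(ltW pR0) ?/W//; lra.
    have lw : lambda <= lambda * omega M (A * t) by rewrite ler_peMr// ltW.
    apply: (@le_trans _ _ (p%:R * ((ln lambda - ln p%:R) + W))).
      by rewrite ler_pM2l// /W; lra.
    rewrite mulrDr; lra.
  (* For [k >= 1], [lambda * k <= p] lets the term of index [p] be bounded by [p * u], where [k * u]
     is the term of index [k] at [A * t]; and [p < (k + 1) * lambda <= 2 * lambda * k]. *)
  have kR0 : (0 : R) < k%:R by rewrite ltr0n.
  have pk2 : p%:R <= 2 * lambda * k%:R.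
    move: pk; rewrite ltr_pdivrMr// -natr1 => /ltW/le_trans; apply.
    rewrite mulrC -mulrA mulrCA ler_pM2l//.
    have : 1 <= k%:R :> R by rewrite ler1n.
    lra.
  have kl : ln k%:R + ln lambda <= ln p%:R.
    rewrite -lnM ?posrE// ler_ln ?posrE ?mulr_gt0//.
    by rewrite -ler_pdivlMr.
  have kp' : (k <= p)%N.
    rewrite -(ler_nat R); apply: (le_trans kp).
    by rewrite ler_pdivrMr// ler_peMr// ltW.
  have H1 := HA k p k0 kp'.
  have wk := omega_ge k Atp; rewrite lnM// ln_nrootM// -mulrBr in wk.
  set u := ln A + ln t - ln (nroot M k) in wk.
  apply: (@le_trans _ _ (p%:R * u)).
    by rewrite ler_pM2l// /u; lra.
  have [u0|u0] := leP u 0.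
    apply: (@le_trans _ _ 0); first by rewrite mulr_ge0_le0// ltW.
    by rewrite !mulr_ge0// ltW.
  apply: (@le_trans _ _ (2 * lambda * k%:R * u)); first by rewrite ler_pM2r.
  by rewrite -mulrA ler_pM2l// mulr_gt0.
(* Applying [key] to [lambda * A] and [t / A] moves the factor [A] from the argument of [omega M]
   into the constant. *)
exists (2 * A); exists (A * t0); split.
- lra.
- by rewrite mulr_ge0 ?(ltW A0)// le_max ler01.
move=> lambda t l1 tt0.
have := key (lambda * A) (A^-1 * t) (mulr_ege1 l1 A1).
have At : A * (A^-1 * t) = t by rewrite mulVKf ?gt_eqF.
rewrite -[lambda * A * (_ * _)]mulrA At (mulrC lambda A) mulrA; apply.
by rewrite mulrC ler_pdivlMr// mulrC.
Qed.

Hypothesis hmg : moderate_growth M.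

Lemma alpha0_nroot : alpha0 (omega M) ->
  exists2 B : R, 1 <= B & forall lambda p, (0 < lambda)%N -> (0 < p)%N ->
    lambda%:R * nroot M p <= B * nroot M (lambda * p).
Proof.
move=> [C [t0 [C1 _ Ha]]].
have [D D1 HD] := moderate_growth_nroot hM hmg.
(* Replacing [p] by [k * p] puts every quotient used beyond [t0], so all [p >= 1] are treated at
   once; moderate growth pays for [k] as well as for [n]. *)
have [k k0 tk] := ratio_unbounded hM t0.
pose n := (Num.trunc C).+1.
have Cn : C <= n%:R by rewrite ltW// truncnS_gt.
exists (D ^+ (n * k)) => [|l p l0 p0]; first exact: exprn_ege1.
have kp0 : (0 < k * p)%N by rewrite muln_gt0 k0.
have lR1 : (1 : R) <= l%:R by rewrite ler1n.
have lR0 : (0 : R) < l%:R by rewrite ltr0n.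
have r0 q := nroot_gt0 (M_gt0 q).
apply: (@le_trans _ _ (l%:R * nroot M (k * p))).
  by rewrite ler_pM2l// nroot_homo// leq_pmull.
apply: le_trans (HD (n * k)%N (l * p)%N _ _); last 2 first.
- by rewrite muln_gt0 k0.
- by rewrite muln_gt0 l0.
(* The index [q = n * l * (k * p)] makes the multiples of [ln (ratio_seq M (k * p))] on the two
   sides of (alpha_0) equal, so they cancel and only roots remain. *)
set q := (n * k * (l * p))%N.
have q0 : (0 < q)%N by rewrite !muln_gt0 k0 l0 p0.
have m0 := ratio_seq_gt0 M_gt0 (k * p).
have kkp : (k <= k * p)%N by rewrite leq_pmulr.
have tm : t0 <= ratio_seq M (k * p).
  by apply: (le_trans tk); rewrite ratio_seq_homo.
have := Ha l%:R _ lR1 tm.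
have := omega_ge q (mulr_gt0 lR0 m0).
have w0 := omega_ge0 (ratio_seq M (k * p)).
rewrite lnM ?posrE// => H1 H2; have {H1 H2} := le_trans H1 H2.
have H3 : C * l%:R * omega M (ratio_seq M (k * p)) <=
          n%:R * l%:R * omega M (ratio_seq M (k * p)).
  by rewrite ler_wpM2r// ler_pM2r.
move=> /le_trans/(_ H3); rewrite omega_ratio// !ln_nrootM// => H.
rewrite -ler_ln ?posrE ?mulr_gt0// lnM ?posrE//.
have qE : q%:R = n%:R * l%:R * (k * p)%:R :> R.
  by rewrite -!natrM; congr (_%:R); rewrite /q; ring.
rewrite -(@ler_pM2l _ q%:R) ?ltr0n//.
move: H; rewrite qE.
set a := ln (ratio_seq _ _); set b := ln l%:R.
set c := ln _; set d := ln _; set N := _%:R; set P := (k * p)%:R.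
lra.
Qed.

End Omega.

(** * The conjugate [phi_star] and the weight matrix *)

Section WeightMatrix.
Context {R : realType} (M : nat -> R).
Hypothesis hM : LC M.
Implicit Types (p q n : nat) (x y l : R).

Let M_gt0 p : 0 < M p. Proof. by case: hM. Qed.

Lemma phi_star_term_le n y :
  n%:R * y - phi (omega M) y <= ln (M n).
Proof.
by have := omega_ge hM n (expR_gt0 y); rewrite expRK /phi; lra.
Qed.

(** As [y >= 0], the slope [x] may be rounded up to an integer [n], for which [ln (M n)] is a
    bound. *)
Lemma phi_star_has_ubound x :
  has_ubound [set x * y - phi (omega M) y | y in [set y : R | 0 <= y]].
Proof.
exists (ln (M (Num.trunc x).+1)) => _ [y /= y0 <-].
apply: le_trans (phi_star_term_le _ y).
by rewrite lerD2r ler_wpM2r// ltW// truncnS_gt.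
Qed.

(** The supremum is attained at [y = ln (ratio_seq M n)], which is admissible because normalization
    makes the quotients at least 1. *)
Lemma phi_star_nat n : (0 < n)%N -> phi_star (omega M) n%:R = ln (M n).
Proof.
move=> n0; have m0 := ratio_seq_gt0 M_gt0 n.
apply/eqP; rewrite eq_le; apply/andP; split.
  apply: ge_sup; first by exists (n%:R * 0 - phi (omega M) 0); exists 0 => /=.
  by move=> _ [y _ <-]; exact: phi_star_term_le.
have -> : ln (M n) =
  n%:R * ln (ratio_seq M n) - phi (omega M) (ln (ratio_seq M n)).
  by rewrite /phi lnK ?posrE// omega_ratio//; lra.
apply: ub_le_sup; first exact: phi_star_has_ubound.
by exists (ln (ratio_seq M n)) => //=; rewrite ln_ge0// LC_ratio_ge1.
Qed.

(** Divided by [x], each term of the supremum becomes [z - phi (omega M) z / x], nondecreasing in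
    [x] because [omega M >= 0]. *)
Lemma phi_star_slope x y : 0 < x -> x <= y ->
  phi_star (omega M) x / x <= phi_star (omega M) y / y.
Proof.
move=> x0 xy; have y0 : 0 < y by exact: lt_le_trans xy.
rewrite ler_pdivrMr// mulrAC; apply: ge_sup.
  by exists (x * 0 - phi (omega M) 0); exists 0 => /=.
move=> _ [z z0 <-]; have w0 := omega_ge0 hM (expR z).
rewrite ler_pdivlMr//.
have : y * z - phi (omega M) z <= phi_star (omega M) y.
  by apply: ub_le_sup; [exact: phi_star_has_ubound|exists z].
rewrite -(ler_pM2r x0) => /(le_trans _); apply.
have := ler_wpM2r w0 xy; rewrite /phi; lra.
Qed.

Lemma nroot_weight_matrix w l p : 0 < l -> (0 < p)%N ->
  nroot (weight_matrix w l) p = expR (phi_star w (l * p%:R) / (l * p%:R)).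
Proof.
move=> l0 p0; rewrite /nroot /weight_matrix -expRM invfM.
by congr expR; ring.
Qed.

Lemma nroot_weight_matrix_nat n p : (0 < n)%N -> (0 < p)%N ->
  nroot (weight_matrix (omega M) n%:R) p = nroot M (n * p).
Proof.
move=> n0 p0; have np0 : (0 < n * p)%N by rewrite muln_gt0 n0.
rewrite nroot_weight_matrix ?ltr0n// -natrM phi_star_nat//.
by rewrite -ln_nroot lnK// posrE nroot_gt0.
Qed.

Lemma nroot_weight_matrix_homo x y p : 0 < x -> x <= y -> (0 < p)%N ->
  nroot (weight_matrix (omega M) x) p <= nroot (weight_matrix (omega M) y) p.
Proof.
move=> x0 xy p0; have y0 : 0 < y by exact: lt_le_trans xy.
have pR0 : (0 : R) < p%:R by rewrite ltr0n.
by rewrite !nroot_weight_matrix// ler_expR phi_star_slope ?mulr_gt0// ler_pM2r.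
Qed.

Let W_gt0 x p : 0 < weight_matrix (omega M) x p. Proof. exact: expR_gt0. Qed.

Definition matrix_root_almost_increasing : Prop :=
  forall x : R, 0 < x ->
    exists C : R, exists y : R,
      [/\ 0 < C, 0 < y
        & forall p q : nat, (1 <= p <= q)%N ->
            div_fact (weight_matrix (omega M) x) p `^ (p%:R)^-1
              <= C * div_fact (weight_matrix (omega M) y) q `^ (q%:R)^-1].

(** The witness [y] is an integer [n >= x]: after enlarging [x] to [n], the indices [n * p <= n * q]
    of [M] itself are compared and the factor [n] cancels. *)
Lemma almost_increasing_matrix :
  almost_increasing (fun p => nroot M p / p%:R) ->
  matrix_root_almost_increasing.
Proof.
move=> [A A1 HA] x x0; have A0 : 0 < A by exact: lt_le_trans A1.
pose n := (Num.trunc x).+1; have nR0 : (0 : R) < n%:R by rewrite ltr0n.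
have xn : x <= n%:R by rewrite ltW// truncnS_gt.
exists (expR 1 * A), n%:R; split=> //; first by rewrite mulr_gt0 ?expR_gt0.
move=> p q /andP[p0 pq]; have q0 : (0 < q)%N by exact: leq_trans pq.
have pR0 : (0 : R) < p%:R by rewrite ltr0n.
apply: (le_trans (nroot_div_fact_le (W_gt0 x _) p0)).
rewrite -mulrA ler_pM2l ?expR_gt0//.
apply: (@le_trans _ _ (A * (nroot (weight_matrix (omega M) n%:R) q / q%:R))).
  apply: (@le_trans _ _ (nroot (weight_matrix (omega M) n%:R) p / p%:R)).
    apply: ler_wpM2r; first by rewrite invr_ge0 ltW.
    exact: (nroot_weight_matrix_homo x0 xn p0).
  rewrite !nroot_weight_matrix_nat//.
  have := HA (n * p)%N (n * q)%N; rewrite muln_gt0 p0 leq_mul// => /(_ isT).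
  rewrite !natrM !invfM -(ler_pM2l nR0) => H.
  by rewrite (le_trans _ (le_trans H _))// le_eqVlt; apply/orP; left;
    apply/eqP; field; rewrite ?gt_eqF ?ltr0n.
by rewrite ler_pM2l// nroot_div_fact_ge.
Qed.

Hypothesis hmg : moderate_growth M.

(** Taking [x = 1] recovers the roots of [M] on the left; on the right [y] is rounded up to [n], and
    moderate growth brings the index [n * q] back to [q]. *)
Lemma matrix_almost_increasing : matrix_root_almost_increasing ->
  almost_increasing (fun p => nroot M p / p%:R).
Proof.
move=> /(_ 1 ltr01)[C [y [C0 y0 H]]].
have [D D1 HD] := moderate_growth_nroot hM hmg.
have D0 : 0 < D by exact: lt_le_trans D1.
pose n := (Num.trunc y).+1; have yn : y <= n%:R by rewrite ltW// truncnS_gt.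
exists (Num.max 1 (C * (expR 1 * D ^+ n))); first by rewrite le_max lexx.
move=> p q /andP[p0 pq]; have q0 : (0 < q)%N by exact: leq_trans pq.
have qR0 : (0 : R) < q%:R by rewrite ltr0n.
apply: (@le_trans _ _ (C * (expR 1 * D ^+ n) * (nroot M q / q%:R))); last first.
  by rewrite ler_wpM2r ?le_max ?lexx ?orbT// divr_ge0 ?powR_ge0.
have {}H := H p q; rewrite p0 pq in H; have {}H := H isT.
have := nroot_weight_matrix_nat (isT : (0 < 1)%N) p0; rewrite mul1n => <-.
apply: (le_trans (nroot_div_fact_ge (W_gt0 1 _) p0)); apply: (le_trans H).
rewrite -!mulrA ler_pM2l//.
apply: (le_trans (nroot_div_fact_le (W_gt0 y _) q0)).
rewrite ler_pM2l ?expR_gt0// mulrA ler_pM2r ?invr_gt0//.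
apply: (le_trans (nroot_weight_matrix_homo y0 yn q0)).
by rewrite nroot_weight_matrix_nat// HD.
Qed.

End WeightMatrix.

(** * Dilation and almost-monotonicity conditions compared *)

Section GrowthConditions.
Context {R : realType} (M : nat -> R).
Hypotheses (hM : LC M) (hmg : moderate_growth M).
Implicit Types (p q n : nat).

Let M_gt0 p : 0 < M p. Proof. by case: hM. Qed.
Let M_lc : log_convex M. Proof. by case: hM. Qed.
Let M0 : M 0%N = 1. Proof. by case: hM => _ []. Qed.

Lemma almost_increasing_ratioE :
  almost_increasing (fun p => nroot M p / p%:R) <->
  almost_increasing (fun p => ratio_seq M p / p%:R).
Proof.
have [D D0 HD] := moderate_growth_ratio hM hmg.
have pV p : (0 < p)%N -> (0 : R) < p%:R^-1 by rewrite invr_gt0 ltr0n.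
have rD p : (0 < p)%N -> ratio_seq M p / p%:R <= D * (nroot M p / p%:R).
  by move=> p0; rewrite mulrA ler_pM2r ?pV// HD.
have rr p : (0 < p)%N -> nroot M p / p%:R <= 1 * (ratio_seq M p / p%:R).
  by move=> p0; rewrite mul1r ler_pM2r ?pV// nroot_le_ratio.
split; [apply: (@almost_increasing_comparable _ _ _ D 1)
       |apply: (@almost_increasing_comparable _ _ _ 1 D)] => // p p0.
  by rewrite divr_ge0// ltW// ratio_seq_gt0.
by rewrite divr_ge0// powR_ge0.
Qed.

Lemma dilation_nroot_ratio :
  (exists2 B : R, 1 <= B & forall l p, (0 < l)%N -> (0 < p)%N ->
     l%:R * nroot M p <= B * nroot M (l * p)) ->
  (exists2 B : R, 1 <= B & forall l p, (0 < l)%N -> (0 < p)%N ->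
     l%:R * ratio_seq M p <= B * ratio_seq M (l * p)).
Proof.
move=> [B B1 HB]; have [D D0 HD] := moderate_growth_ratio hM hmg.
exists (Num.max 1 (D * B)); first by rewrite le_max lexx.
move=> l p l0 p0; have lp0 : (0 < l * p)%N by rewrite muln_gt0 l0.
have B0 : 0 < B by exact: lt_le_trans B1.
apply: (@le_trans _ _ (l%:R * (D * nroot M p))).
  by rewrite ler_pM2l ?ltr0n// HD.
rewrite mulrCA; apply: (@le_trans _ _ (D * (B * ratio_seq M (l * p)))).
  rewrite ler_pM2l//; apply: (le_trans (HB _ _ l0 p0)).
  by rewrite ler_pM2l// nroot_le_ratio.
by rewrite mulrA ler_wpM2r ?le_max ?lexx ?orbT// ltW// ratio_seq_gt0.
Qed.

(** With [l] the integer part of [q / p] one has [l p <= q <= 2 l p]; monotone quotients allow [q]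
    to be replaced by [l p], at the cost of a factor 2. *)
Lemma dilation_almost_increasing :
  (exists2 B : R, 1 <= B & forall l p, (0 < l)%N -> (0 < p)%N ->
     l%:R * ratio_seq M p <= B * ratio_seq M (l * p)) ->
  almost_increasing (fun p => ratio_seq M p / p%:R).
Proof.
move=> [B B1 HB]; have B0 : 0 < B by exact: lt_le_trans B1.
exists (2 * B) => [|p q /andP[p0 pq]]; first lra.
have q0 : (0 < q)%N by exact: leq_trans pq.
have l0 : (0 < q %/ p)%N by rewrite divn_gt0.
set l := (q %/ p)%N in l0; have lpq : (l * p <= q)%N by exact: leq_trunc_div.
have lp0 : (0 < l * p)%N by rewrite muln_gt0 l0.
have mq : ratio_seq M (l * p) <= ratio_seq M q by exact: ratio_seq_homo.
have ql : (q <= 2 * (l * p))%N.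
  have : (p <= l * p)%N by rewrite leq_pmull.
  have := ltn_ceil q p0; rewrite -/l mulSn.
  by lia.
have pR0 : (0 : R) < p%:R by rewrite ltr0n.
have qR0 : (0 : R) < q%:R by rewrite ltr0n.
have lR0 : (0 : R) < l%:R by rewrite ltr0n.
have m0 n := ratio_seq_gt0 M_gt0 n.
rewrite mulrA ler_pdivlMr// mulrAC ler_pdivrMr//.
apply: (@le_trans _ _ (ratio_seq M p * (2 * (l * p))%N%:R)).
  by rewrite ler_pM2l// ler_nat.
rewrite !natrM; apply: (@le_trans _ _ (2 * (B * ratio_seq M (l * p)) * p%:R)).
  have := HB l p l0 p0; rewrite -(ler_pM2r pR0); lra.
by rewrite ler_pM2r// -mulrA !ler_pM2l.
Qed.

Lemma almost_increasing_dilation :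
  almost_increasing (fun p => nroot M p / p%:R) ->
  (exists2 B : R, 1 <= B & forall l p, (0 < l)%N -> (0 < p)%N ->
     l%:R * nroot M p <= B * nroot M (l * p)).
Proof.
move=> [A A1 HA]; exists A => // l p l0 p0.
have pR0 : (0 : R) < p%:R by rewrite ltr0n.
have lR0 : (0 : R) < l%:R by rewrite ltr0n.
have := HA p (l * p)%N; rewrite p0 leq_pmull// => /(_ isT).
rewrite mulrA ler_pdivlMr ?ltr0n ?muln_gt0 ?l0// natrM => H.
by move: H; rewrite mulrCA divfK ?gt_eqF.
Qed.

End GrowthConditions.

(** * Equivalence with a strongly log-convex sequence *)

Section StronglyLogConvex.
Context {R : realType}.
Implicit Types (a c d M N : nat -> R) (p q n : nat).

(** The finite supremum itself serves as [K]: the positive term of index 1 shows that it is positive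
    and not [-oo]. *)
Lemma seq_preceqP M N : (forall p, 0 < M p) -> (forall p, 0 < N p) ->
  seq_preceq M N <->
  exists2 K : R, 0 < K & forall p, (0 < p)%N -> M p <= K ^+ p * N p.
Proof.
move=> M0 N0.
have E p (K : R) : (0 < p)%N -> 0 < K ->
    ((M p / N p) `^ (p%:R)^-1 <= K) = (M p <= K ^+ p * N p).
  move=> p0 K0; rewrite -[LHS]/(nroot (fun p => M p / N p) p <= K).
  rewrite nroot_le ?(ltW K0) ?divr_ge0 ?(ltW (M0 _)) ?(ltW (N0 _))//.
  by rewrite ler_pdivrMr.
split=> [|[K K0 H]].
  rewrite /seq_preceq; set A := (X in ereal_sup X) => supA.
  have ubA : ubound A (ereal_sup A) by exact: ereal_sup_ubound.
  have inA p : (0 < p)%N -> A ((M p / N p) `^ (p%:R)^-1)%:E by exists p.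
  case: (ereal_sup A) supA ubA => [r _ ubA|//|_ /(_ _ (inA 1%N isT))//].
  have r0 : 0 < r.
    have := ubA _ (inA 1%N isT); rewrite lee_fin; apply: lt_le_trans.
    by rewrite powR_gt0 ?divr_gt0.
  by exists r => // p p0; rewrite -E// -lee_fin; exact/ubA/inA.
apply: (@le_lt_trans _ _ K%:E); last exact: ltry.
by apply: ge_ereal_sup => _ [p /= p0 <-]; rewrite lee_fin E// H.
Qed.

(** Serves both for [S], with quotients [p * h p], and for [S] divided by factorials, with quotients
    [h p]. *)
Lemma log_convex_partial_product c d : (forall p, 0 < c p) ->
  (forall p, c p.+1 = c p * d p.+1) -> (forall p, d p.+1 <= d p.+2) ->
  log_convex c.
Proof.
move=> c0 cS dS [//|p] _ /=; rewrite !cS expr2 !mulrA.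
have d0 : 0 < d p.+1 by rewrite -(pmulr_rgt0 _ (c0 p)) -cS.
have -> : c p * d p.+1 * c p * d p.+1 = c p * c p * d p.+1 * d p.+1 by ring.
by rewrite ler_pM2l// !mulr_gt0.
Qed.

(** The maximum runs over the indices from 1 to [n]; the initial value 0 is harmless for the
    positive quotients to which it is applied. *)
Fixpoint running_max a n : R :=
  if n is m.+1 then Num.max (running_max a m) (a n) else 0.

Lemma running_max_homo a n : running_max a n <= running_max a n.+1.
Proof. by rewrite /= le_max lexx. Qed.

Lemma running_max_ge a n : (0 < n)%N -> a n <= running_max a n.
Proof. by case: n => // n _ /=; rewrite le_max lexx orbT. Qed.

Lemma running_max_le a n (b : R) : 0 <= b ->
  (forall p, (0 < p <= n)%N -> a p <= b) -> running_max a n <= b.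
Proof.
move=> b0; elim: n => [//|n IH] H /=; rewrite ge_max H ?leqnn// andbT.
by apply: IH => p /andP[p0 pn]; rewrite H// p0 leqW.
Qed.

Lemma strongly_log_convex_root_almost_increasing M S :
  (forall p, 0 < M p) -> LC S -> seq_equiv M S -> log_convex (div_fact S) ->
  root_almost_increasing M.
Proof.
move=> M0 hS; have [S0 [S00 _] _ _] := hS.
move=> [/seq_preceqP[]// K K0 MS /seq_preceqP[]// L L0 SM] slc.
have f0 p : (0 : R) < p`!%:R by rewrite ltr0n fact_gt0.
have m0 p : 0 < div_fact M p by rewrite divr_gt0.
have s0 p : 0 < div_fact S p by rewrite divr_gt0.
have s00 : div_fact S 0 = 1 by rewrite /div_fact S00 divr1.
exists (Num.max 1 (K * L)); first by rewrite le_max lexx.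
move=> p q /andP[p0 pq]; have q0 : (0 < q)%N by exact: leq_trans pq.
rewrite -/(nroot _ p) -/(nroot _ q).
apply: (@le_trans _ _ (K * L * nroot (div_fact M) q)); last first.
  by rewrite ler_wpM2r ?powR_ge0// le_max lexx orbT.
have compar a c (k : R) n : (0 < n)%N -> 0 < k -> (forall n, 0 < a n) ->
    (forall n, 0 < c n) -> a n <= k ^+ n * c n ->
    nroot (div_fact a) n <= k * nroot (div_fact c) n.
  move=> n0 k0 a0 c0 ac; have cf0 : 0 <= div_fact c n by rewrite divr_ge0// ltW.
  rewrite nroot_le//; last 2 first.
  - by rewrite mulr_ge0 ?powR_ge0// ltW.
  - by rewrite divr_ge0// ltW.
  by rewrite exprMn nrootX// /div_fact mulrA ler_pM2r ?invr_gt0.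
apply: (le_trans (compar _ _ _ _ p0 K0 M0 S0 (MS _ p0))).
rewrite -mulrA ler_pM2l//.
apply: (le_trans _ (compar _ _ _ _ q0 L0 S0 M0 (SM _ q0))).
exact: nroot_homo.
Qed.

Lemma strongly_log_convex_regularization M : LC M ->
  almost_increasing (fun p => ratio_seq M p / p%:R) ->
  exists S, [/\ LC S, seq_equiv M S & log_convex (div_fact S)].
Proof.
move=> hM [A A1 HA]; have A0 : 0 < A by exact: lt_le_trans A1.
have [M0 [M00 M1] Mlc Moo] := hM.
(* [S] is built from its quotients [sigma p = p * h p], so that dividing by [p!] leaves the
   nondecreasing [h]. Almost-increase gives [a <= h <= A * a], hence [M p <= S p <= A ^ p * M p]. *)
pose a p := ratio_seq M p / p%:R; pose h := running_max a.
pose sigma p := p%:R * h p.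
pose S p := \prod_(i < p) sigma i.+1.
have SS p : S p.+1 = S p * sigma p.+1 by rewrite /S big_ord_recr.
have S00 : S 0%N = 1 by rewrite /S big_ord0.
have m0 p := ratio_seq_gt0 M0 p.
have a0 p : (0 < p)%N -> 0 < a p by move=> p0; rewrite divr_gt0 ?ltr0n.
have h0 p : (0 < p)%N -> 0 < h p.
  by move=> p0; apply: lt_le_trans (a0 p p0) _; exact: running_max_ge.
have hA p : (0 < p)%N -> h p <= A * a p.
  move=> p0; apply: running_max_le => [|i ip]; last exact: HA.
  by rewrite mulr_ge0 ?ltW// a0.
have aE p : (0 < p)%N -> p%:R * a p = ratio_seq M p.
  by move=> p0; rewrite mulrCA mulfV ?mulr1// pnatr_eq0 -lt0n.
have sigma_ge p : (0 < p)%N -> ratio_seq M p <= sigma p.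
  by move=> p0; rewrite -aE// ler_pM2l ?ltr0n// running_max_ge.
have sigma_le p : (0 < p)%N -> sigma p <= A * ratio_seq M p.
  by move=> p0; rewrite -aE// mulrCA ler_pM2l ?ltr0n// hA.
have sigma0 p : (0 < p)%N -> 0 < sigma p.
  by move=> p0; apply: lt_le_trans (sigma_ge _ p0).
have S0 p : 0 < S p by elim: p => [|p IH]; rewrite ?S00// SS mulr_gt0// sigma0.
have MS p : M p <= S p.
  elim: p => [|p IH]; first by rewrite M00 S00.
  rewrite SS -(mul_ratio_seq M0).
  by apply: ler_pM; [exact: ltW|exact: ltW| |exact: sigma_ge].
have SM p : S p <= A ^+ p * M p.
  elim: p => [|p IH]; first by rewrite M00 S00 mulr1.
  rewrite SS -(mul_ratio_seq M0) exprS.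
  have -> : A * A ^+ p * (M p * ratio_seq M p.+1) =
    (A ^+ p * M p) * (A * ratio_seq M p.+1) by ring.
  by apply: ler_pM; [exact: ltW|apply/ltW/sigma0| |exact: sigma_le].
exists S; split.
- split=> //.
  + by split=> //; rewrite (le_trans M1).
  + apply: (log_convex_partial_product S0 SS) => p.
    by apply: ler_pM; rewrite ?ler0n ?ler_nat//;
      [apply/ltW/h0|exact: running_max_homo].
  + apply/cvgryPge => x; move/cvgryPge: Moo => /(_ x); apply: filterS => p xM.
    apply: (le_trans xM); apply: ge0_ler_powR;
      rewrite ?nnegrE ?invr_ge0 ?ler0n//.
    - exact: ltW.
    - exact: ltW.
- split; apply/seq_preceqP => //.
    by exists 1 => // p _; rewrite expr1n mul1r.
  by exists A.
- apply: (@log_convex_partial_product _ h) => [p|p|p].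
  + by rewrite divr_gt0// ltr0n fact_gt0.
  + rewrite /div_fact SS factS natrM /sigma; field.
    by rewrite nat1r !pnatr_eq0 -lt0n fact_gt0.
  + exact: running_max_homo.
Qed.

End StronglyLogConvex.

(** * A subadditive majorant of a function of linear growth *)

Section SubadditiveMajorant.
Context {R : realType} (w : R -> R) (H : R).
Hypotheses (w_npos : forall t, t <= 0 -> w t = 0)
  (w_ge0 : forall t, 0 <= w t)
  (w_homo : forall s t, s <= t -> w s <= w t)
  (H_gt0 : 0 < H) (w_linear : forall t, 0 <= t -> w t <= H * t).
Implicit Types s t l b : R.

(* For [0 < t] this is [t * sup_(s >= t) (w s / s)], of the form [t * h t] with
   [h] nonincreasing, hence subadditive. *)
Definition dilation_sup t : R :=
  sup [set w (l * t) / l | l in [set l | 1 <= l]].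

Lemma dilation_sup_le t b :
  (forall l, 1 <= l -> w (l * t) <= l * b) -> dilation_sup t <= b.
Proof.
move=> wb; apply: ge_sup; first by exists (w (1 * t) / 1); exists 1 => /=.
move=> _ [l /= l1 <-]; rewrite ler_pdivrMr ?(lt_le_trans _ l1)// [b * l]mulrC.
exact: wb.
Qed.

(** Linear growth keeps the supremum finite; [Num.max 0 t] covers the negative arguments, where [w]
    vanishes. *)
Lemma dilation_linear t l : 1 <= l -> w (l * t) <= l * (H * Num.max 0 t).
Proof.
move=> l1; have l0 : 0 < l by exact: lt_le_trans l1.
have [t0|t0] := leP t 0; last by rewrite mulrCA w_linear// mulr_ge0// ltW.
by rewrite !mulr0 w_npos// mulr_ge0_le0// ltW.
Qed.

Lemma dilation_sup_has_ubound t :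
  has_ubound [set w (l * t) / l | l in [set l | 1 <= l]].
Proof.
exists (H * Num.max 0 t) => _ [l /= l1 <-].
by rewrite ler_pdivrMr ?(lt_le_trans _ l1)// [_ * l]mulrC dilation_linear.
Qed.

Lemma le_dilation_sup t l : 1 <= l -> w (l * t) <= l * dilation_sup t.
Proof.
move=> l1; rewrite [_ * dilation_sup t]mulrC -ler_pdivrMr ?(lt_le_trans _ l1)//.
by apply: ub_le_sup; [exact: dilation_sup_has_ubound|exists l].
Qed.

Lemma dilation_sup_ge t : w t <= dilation_sup t.
Proof. by have := le_dilation_sup t (lexx 1); rewrite !mul1r. Qed.

Lemma dilation_sup_ge0 t : 0 <= dilation_sup t.
Proof. exact: le_trans (dilation_sup_ge t). Qed.

Lemma dilation_sup_linear t : dilation_sup t <= H * Num.max 0 t.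
Proof. by apply: dilation_sup_le => l; exact: dilation_linear. Qed.

Lemma dilation_sup_npos t : t <= 0 -> dilation_sup t = 0.
Proof.
move=> t0; apply/eqP; rewrite eq_le dilation_sup_ge0 andbT.
by apply: (le_trans (dilation_sup_linear t)); rewrite max_l// mulr0.
Qed.

Lemma dilation_sup_homo s t : s <= t -> dilation_sup s <= dilation_sup t.
Proof.
move=> st; apply: dilation_sup_le => l l1.
apply: le_trans (le_dilation_sup t l1).
by apply: w_homo; rewrite ler_pM2l// (lt_le_trans _ l1).
Qed.

Lemma dilation_sup_subadditive : subadditive_weight dilation_sup.
Proof.
move=> s t; rewrite le_eqVlt => /predU1P[<- _|s0].
  by rewrite (dilation_sup_npos (lexx 0)) !add0r.
rewrite le_eqVlt => /predU1P[<-|t0].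
  by rewrite (dilation_sup_npos (lexx 0)) !addr0.
apply: dilation_sup_le => l l1; set W := w _.
have l0 : 0 < l by exact: lt_le_trans l1.
have st0 : 0 < s + t by exact: addr_gt0.
(* The point [l * (s + t)] is also a dilate of [u], by the factor [l * (s + t) / u >= 1]. Adding the
   bounds for [u = s] and [u = t] gives the claim. *)
have part u : 0 < u -> u <= s + t -> u * W <= l * (s + t) * dilation_sup u.
  move=> u0 ust; have l1' : 1 <= l * (s + t) / u.
    by rewrite ler_pdivlMr// mul1r (le_trans ust)// ler_peMl// ltW.
  have := le_dilation_sup u l1'; rewrite divfK ?gt_eqF// -/W.
  have <- : u * (l * (s + t) / u * dilation_sup u) =
    l * (s + t) * dilation_sup u.
    by field; rewrite gt_eqF.
  by rewrite ler_pM2l.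
have ps : s * W <= l * (s + t) * dilation_sup s by apply: part => //; lra.
have pt : t * W <= l * (s + t) * dilation_sup t by apply: part => //; lra.
rewrite -(ler_pM2l st0); lra.
Qed.

(** For [s > 0], subadditivity reduces the increment to the linear bound at [t - s]. Continuity
    follows without assuming it of [w]. *)
Lemma dilation_sup_lipschitz s t : s <= t ->
  dilation_sup t - dilation_sup s <= H * (t - s).
Proof.
move=> st; have ts0 : 0 <= t - s by rewrite subr_ge0.
have [s0|s0] := leP s 0.
  rewrite (dilation_sup_npos s0) subr0.
  apply: (le_trans (dilation_sup_linear t)).
  by rewrite ler_pM2l// ge_max ts0/=; lra.
have := dilation_sup_subadditive (ltW s0) ts0; rewrite addrC subrK.
have := dilation_sup_linear (t - s); rewrite max_r//; lra.
Qed.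

Lemma dilation_sup_continuous : continuous dilation_sup.
Proof.
move=> x; apply/cvgrPdist_le => e e0; near=> y.
have dxy : H * `|x - y| <= e.
  rewrite mulrC -ler_pdivlMr//; near: y.
  by apply: cvgr_dist_le; [exact: cvg_id|exact: divr_gt0].
apply: le_trans dxy; have [xy|/ltW yx] := leP x y.
  rewrite distrC [X in H * X]distrC !ger0_norm ?subr_ge0 ?dilation_sup_homo//.
  exact: dilation_sup_lipschitz.
rewrite !ger0_norm ?subr_ge0 ?dilation_sup_homo//.
exact: dilation_sup_lipschitz.
Unshelve. all: by end_near. Qed.

End SubadditiveMajorant.

(** * Condition (alpha_0) and subadditive weight functions *)

Section Alpha0.
Context {R : realType} (M : nat -> R).
Hypothesis hM : LC M.
Implicit Types s t l : R.

Lemma omega_unbounded : omega M t @[t --> +oo] --> +oo.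
Proof.
have M0 : 0 < M 1%N by case: hM.
apply/cvgryPge => A; exists (M 1%N * expR A); split; first exact: num_real.
move=> t /= tA; have t0 : 0 < t.
  by rewrite (lt_trans _ tA)// mulr_gt0// expR_gt0.
apply: le_trans (omega_ge hM 1 t0); rewrite mul1r.
move: (ltW tA); rewrite -ler_ln ?posrE ?mulr_gt0 ?expR_gt0//.
by rewrite lnM ?posrE ?expR_gt0// expRK; lra.
Qed.

(** On [[0, 1]] the weight vanishes; for [t >= 1], (alpha_0) at the fixed point [u] with dilation
    [t] gives [omega M t <= omega M (t * u) <= C * t * omega M u]. The added 1 only makes [H]
    positive. *)
Lemma alpha0_linear : alpha0 (omega M) ->
  exists2 H : R, 0 < H & forall t, 0 <= t -> omega M t <= H * t.
Proof.
move=> [C [t0 [C1 _ Ha]]]; pose u := Num.max 1 t0.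
have u1 : 1 <= u by rewrite le_max lexx.
have u0 : 0 < u by exact: lt_le_trans u1.
have tu : t0 <= u by rewrite le_max lexx orbT.
have w0 := omega_ge0 hM u.
exists (1 + C * omega M u) => [|t t0'].
  by rewrite ltr_pwDl// mulr_ge0// (le_trans _ C1).
have [t1|/ltW t1] := leP t 1.
  by rewrite omega_le1// mulr_ge0// addr_ge0// mulr_ge0// (le_trans _ C1).
apply: (@le_trans _ _ (C * t * omega M u)).
  apply: le_trans (Ha t u t1 tu); apply: omega_homo => //.
  by rewrite ler_peMr.
by rewrite mulrAC ler_wpM2r// lerDr.
Qed.

Lemma alpha0_subadditive : alpha0 (omega M) ->
  exists sigma : R -> R,
    [/\ weight_function sigma, subadditive_weight sigma
      & weight_equiv (omega M) sigma].
Proof.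
move=> wa; have [H H0 Hlin] := alpha0_linear wa.
have [C [t0 [C1 _ Ha]]] := wa; have C0 : 0 < C by exact: lt_le_trans C1.
have wn := @omega_npos _ M; have w0 := omega_ge0 hM; have wh := omega_homo hM.
pose sigma := dilation_sup (omega M).
have sigma_ge t : omega M t <= sigma t by exact: (dilation_sup_ge (H := H)).
have sigma0 t : 0 <= sigma t by exact: le_trans (sigma_ge t).
exists sigma; split.
- split.
  + exact/continuous_subspaceT/(dilation_sup_continuous (H := H)).
  + by move=> s t _; exact: (dilation_sup_homo (H := H)).
  + by [].
  + exact: (dilation_sup_npos (H := H)).
  + apply/cvgryPge => A; have /cvgryPge/(_ A) := omega_unbounded.
    by apply: filterS => t /le_trans; apply.
- exact: (dilation_sup_subadditive (H := H)).
- split; apply/eqO_exP.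
    exists 1 => //; near=> t.
    by rewrite mul1r !ger0_norm.
  exists C => //; exists t0; split; first exact: num_real.
  move=> t /= /ltW tt0; rewrite !ger0_norm//.
  by apply: dilation_sup_le => l l1; rewrite mulrA [l * C]mulrC Ha.
Unshelve. all: by end_near. Qed.

Lemma subadditive_alpha0 :
  (exists sigma : R -> R,
    [/\ weight_function sigma, subadditive_weight sigma
      & weight_equiv (omega M) sigma]) ->
  alpha0 (omega M).
Proof.
move=> [sigma [[_ _ s0 _ _] sub]].
move=> [/eqO_exP[k k0 [a [_ ka]]] /eqO_exP[l l0 [b [_ lb]]]].
(* The two O-bounds hold strictly beyond [a] and [b], hence the added 1. *)
pose t0 := 1 + Num.max 0 (Num.max a b).
have t0E : [/\ 0 <= t0, a < t0 & b < t0].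
  rewrite /t0; have : 0 <= Num.max 0 (Num.max a b) by rewrite le_max lexx.
  have : a <= Num.max 0 (Num.max a b) by rewrite !le_max lexx !orbT.
  have : b <= Num.max 0 (Num.max a b) by rewrite !le_max lexx !orbT.
  by split; lra.
case: t0E => t00 at0 bt0.
have subn n t : 0 <= t -> sigma (n.+1%:R * t) <= n.+1%:R * sigma t.
  move=> tp; elim: n => [|n IH]; first by rewrite !mul1r.
  rewrite -[n.+2%:R]natr1 !mulrDl !mul1r.
  by apply: (le_trans (sub _ _ _ tp)); rewrite ?mulr_ge0// lerD2r.
(* Rounding [lam] up to [n + 1 <= 2 * lam] gives the 2; [k] and [l] come from passing to [sigma] and
   back. *)
exists (Num.max 1 (2 * (k * l))), t0; split => //; first by rewrite le_max lexx.
move=> lam t l1 tt0.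
have tp : 0 <= t by exact: le_trans tt0.
pose n := Num.trunc lam.
have lam0 : 0 < lam by exact: lt_le_trans l1.
have /andP[nl ln] := truncn_itv (ltW lam0).
have ntt : t <= n.+1%:R * t by rewrite ler_peMl// ler1n.
have wle : omega M (lam * t) <= omega M (n.+1%:R * t).
  by apply: omega_homo => //; rewrite ler_wpM2r// ltW.
have ka' : omega M (n.+1%:R * t) <= k * sigma (n.+1%:R * t).
  have := ka (n.+1%:R * t).
  rewrite !ger0_norm ?omega_ge0 ?s0 ?mulr_ge0//; apply.
  by apply: lt_le_trans at0 _; exact: le_trans ntt.
have lb' : sigma t <= l * omega M t.
  have := lb t; rewrite !ger0_norm ?omega_ge0 ?s0//; apply.
  exact: lt_le_trans tt0.
have n2 : n.+1%:R <= 2 * lam.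
  by rewrite -natr1 -/n; lra.
have w0 := omega_ge0 hM t.
apply: (le_trans wle); apply: (le_trans ka').
apply: (@le_trans _ _ (k * (n.+1%:R * (l * omega M t)))).
  by rewrite ler_pM2l// (le_trans (subn _ _ tp))// ler_pM2l ?ltr0n.
apply: (@le_trans _ _ (k * (2 * lam * (l * omega M t)))).
  by rewrite ler_pM2l// ler_wpM2r// mulr_ge0// ltW.
have -> : k * (2 * lam * (l * omega M t)) =
  2 * (k * l) * (lam * omega M t) by ring.
rewrite -[leRHS]mulrA ler_wpM2r ?mulr_ge0 ?(ltW lam0)//.
by rewrite le_max lexx orbT.
Qed.

End Alpha0.

(** * The equivalences, proved as one cycle of implications *)

Theorem theorem4p7 (R : realType) (M : nat -> R)
    (hM : LC M) (hmg : moderate_growth M) :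
  [<->
    (* (i) *)
    exists2 B : R, 1 <= B &
      forall lambda p : nat, (0 < lambda)%N -> (0 < p)%N ->
        lambda%:R * M p `^ (p%:R)^-1
          <= B * M (lambda * p)%N `^ ((lambda * p)%N%:R)^-1;
    (* (ii) *)
    exists2 B : R, 1 <= B &
      forall lambda p : nat, (0 < lambda)%N -> (0 < p)%N ->
        lambda%:R * ratio_seq M p <= B * ratio_seq M (lambda * p)%N;
    (* (iii) *)
    root_almost_increasing M;
    (* (iv) *)
    almost_increasing (fun p : nat => ratio_seq M p / p%:R);
    (* (v) *)
    exists S : nat -> R,
      [/\ LC S, seq_equiv M S & log_convex (div_fact S)];
    (* (vi), condition (alpha_0) *)
    alpha0 (omega M);
    (* (vi), equivalence to a subadditive weight function *)
    exists sigma : R -> R,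
      [/\ weight_function sigma, subadditive_weight sigma
        & weight_equiv (omega M) sigma];
    (* (vii) *)
    forall x : R, 0 < x ->
      exists C : R, exists y : R,
        [/\ 0 < C, 0 < y
          & forall p q : nat, (1 <= p <= q)%N ->
              div_fact (weight_matrix (omega M) x) p `^ (p%:R)^-1
                <= C * div_fact (weight_matrix (omega M) y) q `^ (q%:R)^-1]
  ].
Proof.
have [M0 [M00 _] Mlc _] := hM.
have rE := almost_increasing_ratioE hM hmg.
have mE := root_almost_increasingE M0.
have alpha0_ratio : alpha0 (omega M) ->
    almost_increasing (fun p => ratio_seq M p / p%:R).
  move=> /(alpha0_nroot hM hmg)/(dilation_nroot_ratio hM hmg).
  exact: dilation_almost_increasing.
tfae.
- exact: dilation_nroot_ratio.
- by move=> /(dilation_almost_increasing hM)/rE/mE.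
- by move=> /mE/rE.
- exact: strongly_log_convex_regularization.
- move=> [S [hS MS slc]]; apply: (almost_increasing_alpha0 hM); apply/mE.
  exact: strongly_log_convex_root_almost_increasing slc.
- exact: alpha0_subadditive.
(* Subadditivity reaches (vii) by way of (alpha_0) and the almost-increase of the roots divided by
   [p]. *)
- move=> /(subadditive_alpha0 hM)/alpha0_ratio/rE.
  exact: almost_increasing_matrix.
- by move=> /(matrix_almost_increasing hM hmg)/almost_increasing_dilation.
Qed.
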